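(* Let $k\ge 1$. Given a parking preference, all of its rearrangements are $k$-Naples parking functions if and only if its weakly increasing (ascending) rearrangement is a $k$-Naples parking function.
   Context: There are $n$ parking spots $1,\dots,n$ on a one-way street and cars $c_1,\dots,c_n$ arrive in order. A parking preference of length $n$ is a sequence $(a_1,\dots,a_n)\in[n]^n$, $a_j$ being the preferred spot of $c_j$. $k$-Naples rule: car $c_j$ parks in spot $a_j$ if it is empty; otherwise it checks spots $a_j-1,\dots,a_j-k$ (only those $\ge1$) in this order and parks in the first empty one; if all are occupied, it drives forward from $a_j$ and parks in the first empty spot after $a_j$; if none exists, it fails to park. The preference is a $k$-Naples parking function if all cars park. A rearrangement is any permutation of the entries of the sequence. *)

(* Defs.v *)
From mathcomp Require Import all_boot.

Set Implicit Arguments.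
Unset Strict Implicit.
Unset Printing Implicit Defensive.

(* Spots are the natural numbers 1, ..., n, as in the literature (no shift to
   'I_n); a sequence lists the preferred spots in order of arrival. *)
Definition parking_preference (n : nat) (a : seq nat) : bool :=
  (size a == n) && all (fun p => 1 <= p <= n) a.

(* p - 1, ..., p - k in this order, keeping only the spots >= 1; the filter
   i < p also means that the subtraction is never truncated. *)
Definition backward_spots (k p : nat) : seq nat :=
  [seq p - i | i <- iota 1 k & i < p].

Definition forward_spots (n p : nat) : seq nat := iota p.+1 (n - p).

(* None means that the car fails to park. *)
Definition naples_spot (n k : nat) (occ : seq nat) (p : nat) : option nat :=
  if p \notin occ then Some p
  else if ohead [seq q <- backward_spots k p | q \notin occ] is Some q
  then Some q
  else ohead [seq q <- forward_spots n p | q \notin occ].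

(* All cars with preferences s park, starting from the occupied spots occ. *)
Fixpoint naples_all_park (n k : nat) (occ s : seq nat) : bool :=
  if s is p :: s' then
    if naples_spot n k occ p is Some q then naples_all_park n k (q :: occ) s'
    else false
  else true.

Definition naples_parking_function (n k : nat) (a : seq nat) : bool :=
  parking_preference n a && naples_all_park n k [::] a.

(* Main.v *)
Require Import Defs.
From mathcomp Require Import all_boot.
From mathcomp Require Import zify.

(** Suppose that a rearrangement fails, let the cars that fail leave, and let
    [h] be a spot that is empty at the end.  A car that prefers a spot [<= h]
    parks in [[1, h - 1]], and for [h < p <= h + k] a car that prefers a spot of
    [(h, p]] parks in [(h, p]], since otherwise it would have come across [h].
    So fewer than [h] cars prefer spots [<= h], and at most [p - h] cars prefer
    spots of [(h, p]].

    These two conditions do not depend on the order of the cars, and they leave a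
    spot [<= h] empty when the cars arrive in ascending order.  By the second
    one, no car passes [h] backwards: it would need [(h, p]] to be full already.
    If a car that prefers [p <= h] does not park in [[1, h]], then [[1, h]] has
    by the first one an empty spot, which is below [p - k], out of reach of this
    car and hence of all later ones.  If there is no such car, the first
    condition says directly that [[1, h]] is not full. *)

Set Implicit Arguments.
Unset Strict Implicit.
Unset Printing Implicit Defensive.

(** * The parking rule in terms of inequalities *)

(** Each case records the spots that the car has found occupied. Backward reach is written
    [p <= r + k], free of truncated subtraction, and includes [r = p]. *)
Variant naples_spot_spec (n k : nat) (occ : seq nat) (p : nat) :
    option nat -> Prop :=
  | NaplesPreferred of p \notin occ : naples_spot_spec n k occ p (Some p)
  | NaplesBackward q of 0 < q < p & p <= q + k & q \notin occ
      & (forall r, q < r <= p -> r \in occ) : naples_spot_spec n k occ p (Some q)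
  | NaplesForward q of p < q <= n & q \notin occ
      & (forall r, 0 < r <= p -> p <= r + k -> r \in occ)
      & (forall r, p <= r < q -> r \in occ) : naples_spot_spec n k occ p (Some q)
  | NaplesFail
      of (forall r, 0 < r <= p -> p <= r + k -> r \in occ)
      & (forall r, p <= r <= n -> r \in occ) : naples_spot_spec n k occ p None.

Variant ohead_filter_spec (T : eqType) (P : pred T) (s : seq T) :
    option T -> Prop :=
  | OheadFilterSome s1 x s2 of s = s1 ++ x :: s2 & P x & ~~ has P s1 :
      ohead_filter_spec P s (Some x)
  | OheadFilterNone of ~~ has P s : ohead_filter_spec P s None.

Lemma ohead_filterP (T : eqType) (P : pred T) (s : seq T) :
  ohead_filter_spec P s (ohead (filter P s)).
Proof.
elim: s => [|x s IHs] /=; first by constructor.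
case: (boolP (P x)) => Px /=; first by apply: (@OheadFilterSome _ _ _ [::] x s).
case: IHs => [s1 y s2 -> Py Ps1 | Ps].
  by apply: (@OheadFilterSome _ _ _ (x :: s1) y s2) => //=; rewrite (negPf Px).
by constructor; rewrite /= (negPf Px).
Qed.

Lemma mem_backward_spots (k p q : nat) :
  (q \in backward_spots k p) = (0 < q < p) && (p <= q + k).
Proof.
apply/mapP/idP => [[i] | H].
  by rewrite mem_filter mem_iota => H ->; lia.
by exists (p - q); rewrite ?mem_filter ?mem_iota; lia.
Qed.

Lemma backward_spots_sorted (k p : nat) :
  sorted (fun x y => y < x) (backward_spots k p).
Proof.
rewrite /backward_spots sorted_map.
have := sorted_filter ltn_trans (fun i => i < p) (iota_ltn_sorted 1 k).
have : all (fun i => i < p) [seq i <- iota 1 k | i < p] by apply: filter_all.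
apply: (@sub_in_sorted _ (fun i => i < p)) => x y.
by rewrite /relpre /in_mem /= => Hx Hy; lia.
Qed.

Lemma naples_spotP (n k : nat) (occ : seq nat) (p : nat) :
  0 < p -> naples_spot_spec n k occ p (naples_spot n k occ p).
Proof.
move=> p_gt0; rewrite /naples_spot.
case: ifPn => [|/negPn p_occ]; first by constructor.
case: ohead_filterP => [s1 q s2 Es q_free s1_occ | back_occ].
  have: q \in backward_spots k p by rewrite Es mem_cat mem_head orbT.
  rewrite mem_backward_spots => /andP[q_range q_near].
  constructor=> // r /andP[lt_qr le_rp].
  case: (eqVneq r p) => [-> // | ne_rp].
  have: r \in backward_spots k p by rewrite mem_backward_spots; lia.
  (* The backward spots decrease, so [r > q] comes before [q], in [s1], where every spot is
     occupied. *)
  have gt_trans : transitive (fun x y : nat => y < x).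
    by move=> x y z Hxy Hyz; lia.
  have := backward_spots_sorted k p; rewrite Es (sorted_pairwise gt_trans).
  rewrite pairwise_cat => /and3P[_ _ /=/andP[/allP s2_lt _]].
  rewrite mem_cat inE => /or3P[r_s1 | /eqP eq_rq | /s2_lt lt_rq]; try lia.
  by move/hasPn/(_ r r_s1)/negPn: s1_occ.
have near_occ r : 0 < r <= p -> p <= r + k -> r \in occ.
  move=> r_range r_near; case: (eqVneq r p) => [-> // | ne_rp].
  by apply/negPn; apply: (hasPn back_occ); rewrite mem_backward_spots; lia.
case: ohead_filterP => [s1 q s2 Es q_free s1_occ | fwd_occ].
  have: q \in forward_spots n p by rewrite Es mem_cat mem_head orbT.
  rewrite mem_iota => q_range.
  apply: NaplesForward => //; first lia.
  move=> r /andP[le_pr lt_rq]; case: (eqVneq r p) => [-> // | ne_rp].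
  have: r \in forward_spots n p by rewrite mem_iota; lia.
  have := iota_ltn_sorted p.+1 (n - p).
  rewrite -/(forward_spots n p) Es (sorted_pairwise ltn_trans).
  rewrite pairwise_cat => /and3P[_ _ /=/andP[/allP s2_gt _]].
  rewrite mem_cat inE => /or3P[r_s1 | /eqP eq_rq | /s2_gt lt_qr]; try lia.
  by move/hasPn/(_ r r_s1)/negPn: s1_occ.
apply: NaplesFail => // r /andP[le_pr le_rn].
case: (eqVneq r p) => [-> // | ne_rp].
by apply/negPn; apply: (hasPn fwd_occ); rewrite mem_iota; lia.
Qed.

(** * The spots occupied at the end *)

(* Cars that fail to park leave, so that the later cars are still processed. *)
Fixpoint naples_run (n k : nat) (occ s : seq nat) : seq nat :=
  if s is p :: s' then
    naples_run n k (if naples_spot n k occ p is Some q then q :: occ else occ) s'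
  else occ.

Lemma naples_run_subset (n k : nat) (occ s : seq nat) :
  {subset occ <= naples_run n k occ s}.
Proof.
elim: s occ => [|p s IHs] occ x //= x_occ; apply: IHs.
by case: naples_spot => // q; rewrite inE x_occ orbT.
Qed.

Lemma naples_run_uniq (n k : nat) (occ s : seq nat) :
  all (fun p => 0 < p <= n) s -> all (fun p => 0 < p <= n) occ -> uniq occ ->
  uniq (naples_run n k occ s) && all (fun p => 0 < p <= n) (naples_run n k occ s).
Proof.
elim: s occ => [|p s IHs] occ /=; first by move=> _ -> ->.
case/andP=> p_range s_range occ_range occ_uniq.
have p_gt0 : 0 < p by lia.
by apply: IHs => //; case: naples_spotP => //= *; apply/andP; split=> //; lia.
Qed.

Lemma size_naples_run (n k : nat) (occ s : seq nat) :
  size (naples_run n k occ s) <= size occ + size s ?= iff naples_all_park n k occ s.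
Proof.
(* The weak bound comes first: after a failed car it gives the strict inequality. *)
have size_le s' occ' : size (naples_run n k occ' s') <= size occ' + size s'.
  elim: s' occ' => [|p s' IHs] occ' /=; first by rewrite addn0.
  by case: naples_spot => [q|]; apply: leq_trans (IHs _) _ => /=; lia.
apply/leqifP; elim: s occ => [|p s IHs] occ /=; first by rewrite addn0.
case: naples_spot => [q|]; first by have := IHs (q :: occ); rewrite /= addSnnS.
by have := size_le s occ; lia.
Qed.

(** The final spots are distinct and lie in [[1, n]], so [n] cars have parked exactly when no spot
    is left empty. *)
Lemma naples_all_parkP (n k : nat) (a : seq nat) :
  parking_preference n a ->
  reflect (forall h, 0 < h <= n -> h \in naples_run n k [::] a)
          (naples_all_park n k [::] a).
Proof.
case/andP=> /eqP size_a a_range.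
have /andP[run_uniq /allP run_range] :=
  @naples_run_uniq n k [::] a a_range isT isT.
have [size_le size_eq] := size_naples_run n k [::] a.
have run_sub : {subset naples_run n k [::] a <= iota 1 n}.
  by move=> x /run_range; rewrite mem_iota; lia.
rewrite -size_eq /= size_a; apply: (iffP eqP) => [size_run h h_range | run_full].
  have le_n : size (iota 1 n) <= size (naples_run n k [::] a).
    by rewrite size_iota size_run.
  have [_ ->] := uniq_min_size run_uniq run_sub le_n.
  by rewrite mem_iota; lia.
have le_n : size (iota 1 n) <= size (naples_run n k [::] a).
  apply: uniq_leq_size (iota_uniq _ _) _ => x; rewrite mem_iota => ?.
  by apply: run_full; lia.
by move: le_n size_le; rewrite size_iota /= size_a; lia.
Qed.

(** * Counting preferences around an empty spot *)

(** A spot once taken stays taken, so no car parks in [h], and each car that prefers a spot of [X]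
    adds a spot of [X] to the run. The alternative [q == h] spares users of the lemma from excluding
    that case. *)
Lemma count_le_naples_run (X : pred nat) (n k h : nat) (occ s : seq nat) :
  h \notin naples_run n k occ s ->
  (forall (occ' : seq nat) (p : nat), h \notin occ' -> p \in s -> X p ->
     exists2 q, naples_spot n k occ' p = Some q & (q == h) || X q) ->
  count X s + count X occ <= count X (naples_run n k occ s).
Proof.
elim: s occ => [|p s IHs] occ h_free X_closed //=.
move: (h_free) => /= h_free'.
have {}IHs := IHs _ h_free' (fun o q ho qs => X_closed o q ho (@mem_behead _ (p :: s) q qs)).
apply: leq_trans IHs; rewrite [X p + _]addnC -addnA leq_add2l.
case Xp: (X p); last by case: naples_spot => //= q; apply: leq_addl.
have h_occ : h \notin occ by apply: contra h_free; apply: naples_run_subset.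
have [q Eq] := X_closed _ p h_occ (mem_head _ _) Xp.
case: eqP => [q_h _ | _ /= Xq]; last by rewrite Eq /= Xq.
by case/negP: h_free'; rewrite Eq q_h naples_run_subset ?mem_head.
Qed.

Lemma count_interval_le (l m : nat) (X : pred nat) (s : seq nat) :
  uniq s -> (forall x, x \in s -> X x -> l <= x < l + m) -> count X s <= m.
Proof.
move=> s_uniq X_range; rewrite -size_filter -(size_iota l m).
apply: uniq_leq_size; first exact: filter_uniq.
by move=> x; rewrite mem_filter mem_iota => /andP[Xx xs]; apply: X_range.
Qed.

Lemma count_interval_ge (l m : nat) (X : pred nat) (s : seq nat) :
  (forall x, l <= x < l + m -> X x && (x \in s)) -> m <= count X s.
Proof.
move=> X_sub; rewrite -size_filter -{1}(size_iota l m).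
apply: uniq_leq_size; first exact: iota_uniq.
by move=> x; rewrite mem_iota mem_filter; apply: X_sub.
Qed.

Lemma hole_count_le (n k h : nat) (s : seq nat) :
  all (fun p => 0 < p <= n) s -> 0 < h <= n -> h \notin naples_run n k [::] s ->
  count (fun x => x <= h) s < h.
Proof.
move=> s_range h_range h_free.
have /andP[run_uniq /allP run_range] :=
  @naples_run_uniq n k [::] s s_range isT isT.
have: count (fun x => x <= h) s <= count (fun x => x <= h) (naples_run n k [::] s).
  rewrite -[leqLHS]addn0; apply: (count_le_naples_run h_free) => occ p h_occ /(allP s_range) p_range le_ph.
  have p_gt0 : 0 < p by lia.
  case: naples_spotP => // [_|q q_range _ _ _|q q_range _ _ fwd|_ fwd].
  - by exists p; rewrite // le_ph orbT.
  - by exists q => //; lia.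
  - exists q => //; case: (leqP q h) => [|lt_hq]; first by rewrite orbT.
    by case/negP: h_occ; apply: fwd; lia.
  - by case/negP: h_occ; apply: fwd; lia.
have: count (fun x => x <= h) (naples_run n k [::] s) <= h.-1.
  (* Only the [h - 1] spots of [[1, h - 1]] are available, since [h] is empty. *)
  apply: (@count_interval_le 1) => // x x_run le_xh.
  have := run_range _ x_run.
  have : x != h by apply: contraNneq h_free => <-.
  by lia.
by lia.
Qed.

Lemma hole_count_near (n k h p : nat) (s : seq nat) :
  all (fun p => 0 < p <= n) s -> 0 < h <= n -> h \notin naples_run n k [::] s ->
  p <= h + k -> count (fun x => h < x <= p) s <= p - h.
Proof.
move=> s_range h_range h_free p_near.
have /andP[run_uniq /allP run_range] :=
  @naples_run_uniq n k [::] s s_range isT isT.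
pose X x := h < x <= p.
apply: (@leq_trans (count X (naples_run n k [::] s))).
  rewrite -[leqLHS]addn0; apply: (count_le_naples_run h_free).
  move=> occ x h_occ /(allP s_range) x_range x_X; rewrite /X in x_X *.
  have x_gt0 : 0 < x by lia.
  case: naples_spotP => // [_|q q_range _ _ back|q _ _ back _|back _].
  - by exists x; rewrite // x_X orbT.
  - exists q => //; case: (ltngtP q h) => // [lt_qh|]; last by lia.
    by case/negP: h_occ; apply: back; lia.
  - by case/negP: h_occ; apply: back; lia.
  - by case/negP: h_occ; apply: back; lia.
by apply: (@count_interval_le h.+1) => // x _; rewrite /X; lia.
Qed.

(** * The ascending order leaves a spot empty *)

Lemma exists_hole (h : nat) (occ : seq nat) :
  count (fun x => x <= h) occ < h -> exists2 j, 0 < j <= h & j \notin occ.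
Proof.
move=> occ_small; case: (boolP (all (fun j => j \in occ) (iota 1 h))); last first.
  by case/allPn=> j; rewrite mem_iota => ? ?; exists j => //; lia.
move/allP=> occ_full; suff: h <= count (fun x => x <= h) occ by lia.
apply: (@count_interval_ge 1) => x x_range.
by rewrite occ_full ?mem_iota //; lia.
Qed.

(** A car never parks below [p - k]. *)
Lemma naples_run_unreachable (n k j : nat) (occ s : seq nat) :
  0 < j -> all (fun p => j + k < p) s -> j \notin occ ->
  j \notin naples_run n k occ s.
Proof.
move=> j_gt0; elim: s occ => [|p s IHs] occ //= /andP[p_far s_far] j_free.
apply: IHs => //; have p_gt0 : 0 < p by lia.
by case: naples_spotP => // *; rewrite inE negb_or j_free andbT; lia.
Qed.

(* [t] lists the preferences of the cars that have already been processed. *)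
Lemma ascending_hole (n k h : nat) (occ t s : seq nat) :
  h <= n -> all (fun p => 0 < p <= n) s -> sorted leq (t ++ s) ->
  count (fun x => x <= h) (t ++ s) < h ->
  (forall p, h < p <= h + k -> count (fun x => h < x <= p) (t ++ s) <= p - h) ->
  count (fun x => x <= h) occ <= count (fun x => x <= h) t ->
  count (fun x => h < x) occ <= count (fun x => h < x) t ->
  exists2 j, 0 < j <= h & j \notin naples_run n k occ s.
Proof.
move=> le_hn; elim: s t occ => [|p s IHs] t occ /=.
  by rewrite cats0 => _ _ le_small _ occ_le _; apply: exists_hole; lia.
case/andP=> p_range s_range ts_sorted ts_small ts_near occ_le occ_gt.
have p_gt0 : 0 < p by lia.
have := ts_sorted; rewrite (sorted_pairwise leq_trans) pairwise_cat /=.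
case/and3P=> /allrelP t_le_ps _ /andP[/allP p_le_s _].
(* Moving [p] from [s] to [t] keeps both bounds whenever the car parks on its own side of [h]; the
   work lies in the cars that would cross [h]. *)
have IH occ' : count (fun x => x <= h) occ' <= count (fun x => x <= h) t + (p <= h) ->
    count (fun x => h < x) occ' <= count (fun x => h < x) t + (h < p) ->
    exists2 j, 0 < j <= h & j \notin naples_run n k occ' s.
  move=> H1 H2; apply: (IHs (rcons t p)); rewrite ?cat_rcons //.
    by rewrite -cats1 count_cat /= addn0.
  by rewrite -cats1 count_cat /= addn0.
(* If [p] does not park in [[1, h]], it has seen only full spots from [p - k] to [h]. *)
have overflow occ' : p <= h ->
    (forall j, j <= h -> j \in occ' -> j \in occ) ->
    (forall r, 0 < r <= p -> p <= r + k -> r \in occ) ->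
    (forall r, p <= r <= h -> r \in occ) ->
    exists2 j, 0 < j <= h & j \notin naples_run n k occ' s.
  move=> le_ph occ'_low back fwd.
  have [|j j_range j_free] := @exists_hole h occ.
    by move: ts_small; rewrite count_cat /=; lia.
  have j_far : j + k < p.
    rewrite ltnNge; apply/negP => j_near; case/negP: j_free.
    by case: (leqP j p) => ?; [apply: back | apply: fwd]; lia.
  exists j => //; apply: naples_run_unreachable; first lia.
    by apply/allP => x /p_le_s; lia.
  by apply: contra j_free; apply: occ'_low; lia.
case: naples_spotP => // [_|q q_range q_near _ back|q q_range _ back fwd|back fwd].
- by apply: IH => /=; lia.
- case: (leqP p h) => [le_ph | lt_hp]; first by apply: IH => /=; lia.
  case: (leqP q h) => [le_qh | lt_hq]; last by apply: IH => /=; lia.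
  have p_near : h < p <= h + k by lia.
  (* A backward crossing is impossible. Since [p] itself counts, fewer than [p - h] cars of [t]
     prefer spots of [(h, p]]. By the ascending order these are all the cars of [t] beyond [h], too
     few to have filled [(h, p]]. *)
  have := ts_near p p_near; rewrite count_cat /=.
  have -> : count (fun x => h < x <= p) t = count (fun x => h < x) t.
    by apply: eq_in_count => x xt; have := t_le_ps x p xt (mem_head _ _); lia.
  have : p - h <= count (fun x => h < x) occ.
    apply: (@count_interval_ge h.+1) => x x_range.
    by rewrite back ?andbT; lia.
  by lia.
- case: (leqP p h) => [le_ph | lt_hp]; last by apply: IH => /=; lia.
  case: (leqP q h) => [le_qh | lt_hq]; first by apply: IH => /=; lia.
  apply: overflow => //.
  + by move=> j le_jh; rewrite inE => /orP[/eqP|//]; lia.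
  + by move=> r ?; apply: fwd; lia.
- case: (leqP p h) => [le_ph | lt_hp]; last by apply: IH => /=; lia.
  by apply: overflow => // r ?; apply: fwd; lia.
Qed.

Theorem theorem2p4 (n k : nat) (hk : 1 <= k) (a : seq nat)
    (ha : parking_preference n a) :
  (forall b : seq nat, perm_eq b a -> naples_parking_function n k b) <->
  naples_parking_function n k (sort leq a).
Proof.
split=> [all_park | sort_park b b_perm]; first by apply: all_park; rewrite perm_sort.
have b_pref : parking_preference n b.
  by rewrite /parking_preference (perm_size b_perm) (perm_all _ b_perm).
have /andP[sort_pref /(naples_all_parkP _ sort_pref) sort_full] := sort_park.
rewrite /naples_parking_function b_pref /=.
apply/(naples_all_parkP _ b_pref) => h h_range; apply/negPn/negP => h_free.
have /andP[_ b_range] := b_pref.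
have /andP[_ sort_range] := sort_pref.
have sort_perm : perm_eq (sort leq a) b by rewrite perm_sort perm_sym.
(* The hole [h] of [b] bounds the counts for [b], hence those for [sort leq a], whose run then has a
   hole [j] as well. *)
have [| | | | | | |j j_range] := @ascending_hole n k h [::] [::] (sort leq a) => //=.
- by lia.
- exact: sort_sorted leq_total a.
- by rewrite (permP sort_perm); apply: hole_count_le h_free.
- move=> p /andP[_ p_near]; rewrite (permP sort_perm).
  exact: hole_count_near h_free p_near.
- by rewrite sort_full //; lia.
Qed.
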